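(* Let $M=[v_1|\cdots|v_n]$ be a nonnegative $3\times n$ real matrix with $\operatorname{rank}(M)=3$. Then every $3\times3$ minor of $M$ is nonnegative if and only if $M$ can be constructed from the $3\times3$ identity matrix $I_3$.
   Context: A $3\times3$ minor is the determinant of a submatrix formed by three columns kept in their order in the matrix. Column operations on a matrix $[v_1|\cdots|v_n]$: Join: replace adjacent columns $v_i,v_{i+1}$ by $v_i+v_{i+1}$; Double: replace $v_i$ by two adjacent copies $v_i|v_i$; Cyclic shift: $[v_1|\cdots|v_n]\mapsto[v_n|v_1|\cdots|v_{n-1}]$; Re-scale: replace $v_i$ by $a v_i$, $a\ge0$. $M$ can be constructed from $M'$ if $M$ is obtained from $M'$ by a finite sequence of these operations. *)

(* Defs.v *)
From Stdlib Require Export Relation_Operators.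
From mathcomp Require Export all_boot all_order all_algebra.
From mathcomp Require Export reals.

Set Implicit Arguments.
Unset Strict Implicit.
Unset Printing Implicit Defensive.

Import Order.TTheory GRing.Theory Num.Theory.
Local Open Scope ring_scope.

(* The operations change the number of columns, so they are stated on the
   sequence [:: v_1; ...; v_n] of columns of [v_1|...|v_n]. *)
Definition cols (R : realType) (m n : nat) (M : 'M[R]_(m, n)) :
    seq 'cV[R]_m :=
  [seq col j M | j <- enum 'I_n].

Inductive column_op (R : realType) (m : nat) :
    seq 'cV[R]_m -> seq 'cV[R]_m -> Prop :=
| column_join (s t : seq 'cV[R]_m) (v w : 'cV[R]_m) :
    column_op (s ++ [:: v, w & t]) (s ++ [:: v + w & t])
| column_double (s t : seq 'cV[R]_m) (v : 'cV[R]_m) :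
    column_op (s ++ [:: v & t]) (s ++ [:: v, v & t])
| column_shift (s : seq 'cV[R]_m) (v : 'cV[R]_m) :
    column_op (rcons s v) (v :: s)
| column_rescale (s t : seq 'cV[R]_m) (v : 'cV[R]_m) (a : R) :
    0 <= a -> column_op (s ++ [:: v & t]) (s ++ [:: a *: v & t]).

Definition constructible_from (R : realType) (m n n' : nat)
    (M' : 'M[R]_(m, n')) (M : 'M[R]_(m, n)) : Prop :=
  clos_refl_trans (seq 'cV[R]_m) (@column_op R m) (cols M') (cols M).

Definition minors3_nonneg (R : realType) (n : nat) (M : 'M[R]_(3, n)) : Prop :=
  forall f : 'I_3 -> 'I_n, (forall i j : 'I_3, (i < j)%N -> (f i < f j)%N) ->
    0 <= \det (colsub f M).

(* Main.v *)
Require Import Defs.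
From mathcomp Require Import all_boot all_order all_algebra.
From mathcomp Require Import boolp reals ring lra.

Set Implicit Arguments.
Unset Strict Implicit.
Unset Printing Implicit Defensive.

Import Order.TTheory GRing.Theory Num.Theory.
Local Open Scope ring_scope.

(* Every column operation preserves nonnegativity of the minors: a cyclic shift
   is an even permutation of three columns, and after rotating, the other
   operations act on the first column, in which minors are linear.

   Conversely, read nonzero nonnegative columns as points of the triangle
   spanned by e_1, e_2, e_3. A column in the cone of its two cyclic neighbours
   can be inserted afterwards, so by induction on the number of columns no such
   column exists, and then det(v_k, v_(k+1), v_l) > 0 for all l <> k, k+1.
   Cutting the triangle by the line through v_n and v_1 constructs a sequence
   v_1, x_1, ..., x_m = v_n all of whose edges have every v_k on their left. If
   a = v_k is already in place, the ray from a through b = v_(k+1) leaves this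
   polygonal path on some edge (x_j, x_(j+1)), at a point q; dropping
   x_1, ..., x_j and inserting q, then b between a and q, puts b in place and
   leaves the path b, q, x_(j+1), ..., v_n, again with the remaining columns on
   its left. *)

(** * Derived operations: rotation, deletion, insertion of cone combinations *)

Section Reachability.
Variables (R : realType) (m : nat).
Implicit Types (s t x : seq 'cV[R]_m) (u v w : 'cV[R]_m).

Definition reach s t : Prop := clos_refl_trans _ (@column_op R m) s t.

Lemma reach_refl s : reach s s.
Proof. exact: rt_refl. Qed.

Lemma reach_trans t s x : reach s t -> reach t x -> reach s x.
Proof. exact: rt_trans. Qed.

Lemma reach_rot s t : reach (s ++ t) (t ++ s).
Proof.
elim/last_ind: t s => [|t v IHt] s; first by rewrite cats0; apply: reach_refl.
rewrite -rcons_cat; apply: (@reach_trans (v :: s ++ t)).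
  by apply: rt_step; apply: column_shift.
by rewrite cat_rcons; apply: (IHt (v :: s)).
Qed.

(** A column is deleted by rescaling it by 0 and joining it to its neighbour. *)
Lemma reach_delr s t v w : reach (s ++ [:: v, w & t]) (s ++ v :: t).
Proof.
apply: (@reach_trans (s ++ [:: v, 0 *: w & t])).
  rewrite -2!(cat_rcons v); apply: rt_step.
  exact: column_rescale.
have -> : s ++ v :: t = s ++ (v + 0 *: w) :: t by rewrite scale0r addr0.
by apply: rt_step; apply: column_join.
Qed.

Lemma reach_dell s t v w : reach (s ++ [:: v, w & t]) (s ++ w :: t).
Proof.
apply: (@reach_trans (s ++ [:: 0 *: v, w & t])).
  by apply: rt_step; apply: column_rescale.
have -> : s ++ w :: t = s ++ (0 *: v + w) :: t by rewrite scale0r add0r.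
by apply: rt_step; apply: column_join.
Qed.

Lemma reach_del_cat s x t w : reach (s ++ x ++ w :: t) (s ++ w :: t).
Proof.
elim: x s => [|v x IHx] s; first exact: reach_refl.
rewrite cat_cons -cat_rcons; apply: (@reach_trans _ _ _ (IHx _)).
by rewrite cat_rcons; apply: reach_dell.
Qed.

(** Double [v] and [w], rescale the two inner copies by [a] and [b], and join them. *)
Lemma reach_insert (a b : R) s t v w : 0 <= a -> 0 <= b ->
  reach (s ++ [:: v, w & t]) (s ++ [:: v, a *: v + b *: w, w & t]).
Proof.
move=> a0 b0; have E x : s ++ v :: x = rcons s v ++ x by rewrite cat_rcons.
apply: (@reach_trans (s ++ [:: v, v, w & t])).
  by apply: rt_step; apply: column_double.
rewrite !E; apply: (@reach_trans (rcons s v ++ [:: a *: v, w & t])).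
  by apply: rt_step; apply: column_rescale.
have F x : rcons s v ++ a *: v :: x = rcons (rcons s v) (a *: v) ++ x.
  by rewrite (cat_rcons (a *: v)).
apply: (@reach_trans (rcons s v ++ [:: a *: v, w, w & t])).
  by rewrite !F; apply: rt_step; apply: column_double.
apply: (@reach_trans (rcons s v ++ [:: a *: v, b *: w, w & t])).
  by rewrite !F; apply: rt_step; apply: column_rescale.
by apply: rt_step; apply: column_join.
Qed.

End Reachability.

(** * Determinants of three columns as explicit polynomials *)

Section Det3.
Variable R : realType.
Implicit Types (u v w x y z : 'cV[R]_3) (s t : seq 'cV[R]_3).

(** The functional [det3 u v] as a row vector, so that [spanning] can be applied to it. *)
Definition crossp u v : 'rV[R]_3 :=
  \row_j if j == 0 then u 1 0 * v 2 0 - u 2 0 * v 1 0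
         else if j == 1 then u 2 0 * v 0 0 - u 0 0 * v 2 0
         else u 0 0 * v 1 0 - u 1 0 * v 0 0.

Definition det3 u v w : R :=
  (u 1 0 * v 2 0 - u 2 0 * v 1 0) * w 0 0 +
  (u 2 0 * v 0 0 - u 0 0 * v 2 0) * w 1 0 +
  (u 0 0 * v 1 0 - u 1 0 * v 0 0) * w 2 0.

Lemma ord3P (P : 'I_3 -> Prop) : P 0 -> P 1 -> P 2 -> forall i, P i.
Proof.
move=> P0 P1 P2 [[|[|[|//]]] lti].
- by rewrite (_ : Ordinal lti = 0) //; apply: val_inj.
- by rewrite (_ : Ordinal lti = 1) //; apply: val_inj.
- by rewrite (_ : Ordinal lti = 2) //; apply: val_inj.
Qed.

Lemma big_ord3 (F : 'I_3 -> R) : \sum_i F i = F 0 + F 1 + F 2.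
Proof.
rewrite !big_ord_recl big_ord0 addr0 addrA.
by congr (F _ + F _ + F _); apply: val_inj.
Qed.

Lemma mul_crossp u v w : (crossp u v *m w) 0 0 = det3 u v w.
Proof. by rewrite mxE big_ord3 !mxE. Qed.

Lemma col3P u v : u 0 0 = v 0 0 -> u 1 0 = v 1 0 -> u 2 0 = v 2 0 -> u = v.
Proof.
move=> e0 e1 e2; apply/matrixP => i j; rewrite ord1.
by move: i; apply: ord3P.
Qed.

Lemma det3C u v w : det3 v w u = det3 u v w.
Proof. rewrite /det3; ring. Qed.

Lemma det3N u v w : det3 v u w = - det3 u v w.
Proof. rewrite /det3; ring. Qed.

Lemma cramer3 x y z b : det3 x y z *: b =
  det3 b y z *: x + det3 x b z *: y + det3 x y b *: z.
Proof. by apply: col3P; rewrite /det3 !mxE; ring. Qed.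

Lemma det_colsub n (M : 'M[R]_(3, n)) (f : 'I_3 -> 'I_n) :
  \det (colsub f M) = det3 (col (f 0) M) (col (f 1) M) (col (f 2) M).
Proof.
(* Indexing the entries by natural numbers lets the ordinals of the cofactor expansion compute, so
   that [ring] recognises equal entries. *)
pose g i j := M (inord i) (f (inord j)).
have E i j : M i (f j) = g i j by rewrite /g !inord_val.
rewrite (expand_det_row _ 0) big_ord3 /cofactor !(expand_det_row _ ord0).
rewrite !big_ord_recl !big_ord0 /cofactor !det_mx11 /det3 !mxE !E /=.
rewrite /bump /=; ring.
Qed.

Definition nonneg v := forall i, 0 <= v i 0.
(** A linear functional positive on nonzero nonnegative columns: applied to a vector identity, it
    yields a scalar one from which the sign of a coefficient is read off. *)
Definition coordsum v : R := v 0 0 + v 1 0 + v 2 0.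

Lemma coordsumD u v : coordsum (u + v) = coordsum u + coordsum v.
Proof. by rewrite /coordsum !mxE; ring. Qed.
Lemma coordsumZ a v : coordsum (a *: v) = a * coordsum v.
Proof. by rewrite /coordsum !mxE; ring. Qed.

Lemma coordsum_ge0 v : nonneg v -> 0 <= coordsum v.
Proof. by move=> v0; rewrite /coordsum !addr_ge0. Qed.

Lemma coordsum_gt0 v : nonneg v -> v != 0 -> 0 < coordsum v.
Proof.
move=> v0 vn0; rewrite lt_neqAle coordsum_ge0 // andbT eq_sym.
apply: contra_neq vn0 => T0; have := v0 0; have := v0 1; have := v0 2.
by rewrite /coordsum in T0 => *; apply: col3P; rewrite !mxE; lra.
Qed.

Lemma nonneg_cone (a b : R) u v : 0 <= a -> 0 <= b -> nonneg u -> nonneg v ->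
  nonneg (a *: u + b *: v).
Proof. by move=> a0 b0 u0 v0 i; rewrite !mxE addr_ge0 ?mulr_ge0. Qed.

End Det3.

(** * Nonnegative minors and spanning for sequences of columns *)

Section TNN.
Variable R : realType.
Implicit Types (u v w x y z : 'cV[R]_3) (s t : seq 'cV[R]_3).

Definition tnn s := forall u v w, subseq [:: u; v; w] s -> 0 <= det3 u v w.

Lemma tnn_subseq s t : subseq s t -> tnn t -> tnn s.
Proof. by move=> st tt u v w /subseq_trans/(_ st)/tt. Qed.

Lemma tnn_cons a s :
  tnn (a :: s) <-> tnn s /\ forall v w, subseq [:: v; w] s -> 0 <= det3 a v w.
Proof.
split=> [H | [Hs Ha] u v w].
  split; first exact: tnn_subseq (subseq_cons _ _) H.
  by move=> v w vw; apply: H; rewrite /= eqxx.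
by rewrite /=; case: eqP => [-> /Ha | _ /Hs].
Qed.

Lemma tnn_rot s t : tnn (s ++ t) -> tnn (t ++ s).
Proof.
elim/last_ind: t s => [|t v IHt] s; first by rewrite cats0.
rewrite -rcons_cat cat_rcons => H; apply: (IHt (v :: s)).
rewrite cat_cons; apply/tnn_cons; split.
  by apply: tnn_subseq H; apply: subseq_rcons.
move=> u w uw; rewrite -det3C; apply: H.
by rewrite -[[:: u; w; v]]/([:: u; w] ++ [:: v]) -cats1 cat_subseq.
Qed.

Lemma column_op_tnn s t : column_op s t -> tnn s -> tnn t.
Proof.
case=> [{}s {}t v w|{}s {}t v|{}s v|{}s {}t v a a0].
- move=> /tnn_rot /= /tnn_cons[/tnn_cons[H1 H2] H3].
  apply: tnn_rot => /=; apply/tnn_cons; split=> // x y xy.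
  rewrite (_ : det3 _ _ _ = det3 v x y + det3 w x y).
    rewrite addr_ge0 ?H2 ?H3 //.
    exact: subseq_trans xy (subseq_cons _ _).
  by rewrite /det3 !mxE; ring.
- move=> /tnn_rot /= H.
  apply: tnn_rot => /=; apply/tnn_cons; split=> // x y /=.
  case: eqP => [-> _ | _ xy].
    by rewrite (_ : det3 _ _ _ = 0) // /det3; ring.
  by move/tnn_cons: H => [_]; apply.
- by rewrite -cats1 => /tnn_rot.
- move=> /tnn_rot /= /tnn_cons[H1 H2].
  apply: tnn_rot => /=; apply/tnn_cons; split=> // x y /H2 xy.
  rewrite (_ : det3 _ _ _ = a * det3 v x y) ?mulr_ge0 //.
  by rewrite /det3 !mxE; ring.
Qed.

Lemma reach_tnn s t : reach s t -> tnn s -> tnn t.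
Proof.
by elim=> {s t} [s t /column_op_tnn // | // | s t r _ IH1 _ IH2 /IH1].
Qed.

(** Rank 3 in dual form, ready to be tested on the functionals [crossp u v]. *)
Definition spanning s :=
  forall f : 'rV[R]_3, (forall v, v \in s -> f *m v = 0) -> f = 0.

Lemma mul_row_col_eq0 (f : 'rV[R]_3) v : (f *m v) 0 0 = 0 -> f *m v = 0.
Proof. by move=> fv; apply/matrixP => i j; rewrite !ord1 fv mxE. Qed.

Lemma crossp_eq0 s u v : spanning s -> (forall c, c \in s -> det3 u v c = 0) ->
  crossp u v = 0.
Proof.
move=> sp H; apply: sp => c /H uvc.
by apply: mul_row_col_eq0; rewrite mul_crossp.
Qed.

Lemma det3_crossp0 u v w : crossp u v = 0 -> det3 u v w = 0.
Proof. by move=> uv; rewrite -mul_crossp uv mul0mx mxE. Qed.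

Lemma crossp_coord u v : crossp u v = 0 ->
  [/\ u 1 0 * v 2 0 = u 2 0 * v 1 0, u 2 0 * v 0 0 = u 0 0 * v 2 0
    & u 0 0 * v 1 0 = u 1 0 * v 0 0].
Proof.
move/rowP => H.
by have := H 0; have := H 1; have := H 2; rewrite !mxE /= => *; split; lra.
Qed.

Lemma spanning_det3 s : spanning s ->
  exists u v w, [/\ u \in s, v \in s, w \in s & det3 u v w != 0].
Proof.
move=> sp; apply: contrapT => H.
have D0 u v w : u \in s -> v \in s -> w \in s -> det3 u v w = 0.
  move=> us vs ws; case: (eqVneq (det3 u v w) 0) => // uvw.
  by exfalso; apply: H; exists u, v, w.
have C0 u v : u \in s -> v \in s -> crossp u v = 0.
  by move=> us vs; apply: (crossp_eq0 sp) => c; apply: D0.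
have s0 u : u \in s -> u = 0.
  (* Since [crossp u c = 0] for every column [c], [det3 u e c = - det3 u c e = 0] for arbitrary [e].
     So [u] is parallel to every vector, hence zero. *)
  move=> us; have E e : crossp u e = 0.
    apply: (crossp_eq0 sp) => c cs.
    by rewrite -det3C det3N det3C det3_crossp0 ?oppr0 // C0.
  have [_ e1 e2] := crossp_coord (E (delta_mx 0 0)).
  have [e3 e4 _] := crossp_coord (E (delta_mx 2 0)).
  by apply: col3P; move: e1 e2 e3 e4; rewrite !mxE /=; lra.
have E : delta_mx 0 0 = 0 :> 'rV[R]_3.
  by apply: sp => v /s0 ->; rewrite mulmx0.
by move/matrixP/(_ 0 0)/eqP: E; rewrite !mxE oner_eq0.
Qed.

Lemma spanning_size s : spanning s -> (2 < size s)%N.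
Proof.
move=> /spanning_det3[u [v [w [us vs ws D]]]].
apply: (@leq_trans (size [:: u; v; w])) => //; apply: uniq_leq_size.
  rewrite /= !inE negb_or !andbT; apply/andP.
  split; first apply/andP; first split.
  - by apply: contra_neq D => ->; rewrite /det3; ring.
  - by apply: contra_neq D => ->; rewrite /det3; ring.
  - by apply: contra_neq D => ->; rewrite /det3; ring.
by move=> x; rewrite !inE => /or3P[] /eqP ->.
Qed.

Definition good s := [/\ {in s, forall v, nonneg v}, tnn s & spanning s].

Lemma good_rot s t : good (s ++ t) -> good (t ++ s).
Proof.
case=> n0 tn sp; split; first by move=> v; rewrite mem_cat orbC -mem_cat => /n0.
  exact: tnn_rot.
by move=> f H; apply: sp => v; rewrite mem_cat orbC -mem_cat => /H.
Qed.

Lemma good_remove (l m : R) a b c t : b = l *: a + m *: c ->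
  good [:: a, b, c & t] -> good [:: a, c & t].
Proof.
have sub : subseq [:: a, c & t] [:: a, b, c & t].
  by apply: (@cat_subseq _ [:: a] _ [:: a]) => //; apply: subseq_cons.
move=> eb [n0 tn sp]; split.
- by move=> v /(mem_subseq sub)/n0.
- exact: tnn_subseq tn.
move=> f H; apply: sp => v; rewrite !inE => /or4P[/eqP->|/eqP->|/eqP->|vt].
- by apply: H; rewrite inE eqxx.
- by rewrite eb mulmxDr -!scalemxAr !H ?scaler0 ?addr0 // !inE eqxx ?orbT.
- by apply: H; rewrite !inE eqxx orbT.
- by apply: H; rewrite !inE vt !orbT.
Qed.

Lemma nonneg_parallel u v : nonneg u -> nonneg v -> u != 0 -> crossp u v = 0 ->
  exists2 l, 0 <= l & v = l *: u.
Proof.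
move=> u0 v0 un0 /crossp_coord[e0 e1 e2]; have T := coordsum_gt0 u0 un0.
(* The ratio of coordinate sums is the factor whichever coordinate of [u] is nonzero. *)
exists (coordsum v / coordsum u).
  by rewrite divr_ge0 ?coordsum_ge0.
have Tn0 := lt0r_neq0 T.
by apply: col3P; rewrite !mxE mulrAC; apply: (mulIf Tn0);
  rewrite divfK // /coordsum; lra.
Qed.

End TNN.

(** * Columns in the cone of their cyclic neighbours *)

Section Reduction.
Variable R : realType.
Implicit Types (u v w x y z : 'cV[R]_3) (s t : seq 'cV[R]_3).

Section Dichotomy.
Variables (base : seq 'cV[R]_3) (n : nat).
Hypothesis IHn : forall s, (size s < n)%N -> good s -> reach base s.

Lemma reach_of_cone (l m : R) a b c t : 0 <= l -> 0 <= m ->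
  b = l *: a + m *: c -> (size t + 3 <= n)%N -> good [:: a, b, c & t] ->
  reach base [:: a, b, c & t].
Proof.
move=> l0 m0 eb sz g; apply: (@reach_trans _ _ [:: a, c & t]).
  by apply: IHn (good_remove eb g); rewrite /= -addn3.
by rewrite eb; apply: (reach_insert [::]).
Qed.

(** A zero column lies in the cone of any two columns. A spanning sequence has at least three
    columns, so a rotation puts the zero between two others. *)
Lemma reach_of_zero s : (size s <= n)%N -> good s -> 0 \in s -> reach base s.
Proof.
move=> sz g /splitPr e; case: e sz g => s1 s2 sz /good_rot g.
apply: reach_trans (reach_rot (0 :: s2) s1).
rewrite !size_cat /= addnS addnC -size_cat in sz.
move: g sz; rewrite cat_cons; move: (s2 ++ s1) => {s1 s2} t.
case: t => [[_ _ /spanning_size] // | x t].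
case/lastP: t => [[_ _ /spanning_size] // | t y] g.
rewrite /= size_rcons => sz.
rewrite -!rcons_cons -cats1 in g *.
apply: reach_trans (reach_rot [:: y] _).
apply: (@reach_of_cone 0 0) => //; last exact: good_rot g.
  by rewrite !scale0r addr0.
by rewrite addn3.
Qed.

(* A column z of t in the plane of a and b is a combination of a and b, and a
   column d off the plane, placed before or after z, forces opposite signs. *)
Lemma reach_or_strict a b t : (size t + 2 <= n)%N -> good [:: a, b & t] ->
  reach base [:: a, b & t] \/ {in t, forall c, 0 < det3 a b c}.
Proof.
move=> sz g; have [/reach_of_zero H | s0] := boolP (0 \in [:: a, b & t]).
  by left; apply: H => //; rewrite /= -addn2.
have nz c : c \in [:: a, b & t] -> c != 0.
  by move=> cs; apply: contraNneq s0 => <-.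
have [n0 tn sp] := g.
have [ab | ab] := eqVneq (crossp a b) 0.
  have [|||l l0 eb] := nonneg_parallel _ _ _ ab.
  - by apply: n0; rewrite inE eqxx.
  - by apply: n0; rewrite !inE eqxx orbT.
  - by apply: nz; rewrite inE eqxx.
  left; case: t sz g {n0 tn s0 nz} sp => [_ _ /spanning_size //|c t] sz g _.
  apply: (@reach_of_cone l 0) => //; first by rewrite scale0r addr0.
  by move: sz => /=; rewrite addn2 addn3.
have D0 c : c \in t -> 0 <= det3 a b c.
  by move=> ct; apply: tn; rewrite /= !eqxx sub1seq.
(* Otherwise the nonzero functional [crossp a b] would vanish on all columns. *)
have [d dt dD] : exists2 d, d \in t & 0 < det3 a b d.
  apply: contrapT => H; case/eqP: ab; apply: (crossp_eq0 sp) => c.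
  rewrite !inE => /or3P[/eqP->|/eqP->|ct]; try by rewrite /det3; ring.
  have := D0 _ ct; rewrite le_eqVlt => /orP[/eqP //|H1].
  by case: H; exists c.
have T c : c \in [:: a, b & t] -> 0 < coordsum c.
  by move=> cs; apply: coordsum_gt0; [apply: n0 | apply: nz].
have Ta := T a (mem_head _ _).
have Tb : 0 < coordsum b by apply: T; rewrite !inE eqxx orbT.
have Tt c : c \in t -> 0 < coordsum c.
  by move=> ct; apply: T; rewrite !inE ct !orbT.
have S c c' : subseq [:: c; c'] t -> 0 <= det3 a c c' /\ 0 <= det3 b c c'.
  move=> cc; split; apply: tn.
    by apply: (@cat_subseq _ [:: a] _ [:: a; b]); rewrite ?sub1seq ?mem_head.
  by apply: (@cat_subseq _ [:: b] _ [:: a; b]); 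
     rewrite ?sub1seq ?inE ?eqxx ?orbT.
(* Cramer's rule for [z] with respect to [a], [b], [d']: the coefficient of [d'] is
   [det3 a b z = 0], and the order of [z] and [d'] decides the signs of the other two. *)
have after z d' : det3 a b z = 0 -> subseq [:: z; d'] t ->
    det3 a b d' *: z + det3 b z d' *: a = det3 a z d' *: b.
  move=> z0 zd; rewrite cramer3 z0 scale0r addr0.
  by rewrite [det3 z b d']det3N addrAC scaleNr addNr add0r.
have before z d' : det3 a b z = 0 -> subseq [:: d'; z] t ->
    det3 a b d' *: z + det3 a d' z *: b = det3 b d' z *: a.
  move=> z0 zd; rewrite cramer3 z0 scale0r addr0.
  have -> : det3 z b d' = det3 b d' z by rewrite -det3C.
  have -> : det3 a z d' = - det3 a d' z by rewrite -det3C det3N det3C.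
  by rewrite scaleNr -addrA addNr addr0.
case: t => [|c1 t] in sz g n0 tn sp s0 nz D0 d dt dD T Tt S after before *.
  by rewrite in_nil in dt.
(* If [c1] lies in the plane of [a] and [b], [after] puts [b] in the cone of its neighbours [a] and
   [c1]; coordinate sums show that the divisor [det3 a c1 d] is positive. *)
have := D0 c1 (mem_head _ _); rewrite le_eqVlt => /orP[/eqP/esym c10 | c1p].
  left; move: dt; rewrite inE => /orP[/eqP ed|dt].
    by move: dD; rewrite ed c10 ltxx.
  have sub : subseq [:: c1; d] (c1 :: t) by rewrite /= eqxx sub1seq.
  have [A0 B0] := S _ _ sub; have E := after _ _ c10 sub.
  have A1 : 0 < det3 a c1 d.
    have := congr1 (@coordsum R) E; rewrite coordsumD !coordsumZ => E'.
    rewrite -(pmulr_lgt0 _ Tb) -E' ltr_pwDl ?mulr_ge0 ?(ltW Ta) //.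
    by rewrite mulr_gt0 // Tt // mem_head.
  apply: (@reach_of_cone (det3 b c1 d / det3 a c1 d)
                         (det3 a b d / det3 a c1 d)) => //.
  - by rewrite divr_ge0.
  - by rewrite divr_ge0 // ltW.
  - rewrite ![_ / det3 a c1 d]mulrC -!scalerA -scalerDr addrC E scalerA.
    by rewrite mulVf ?scale1r // lt0r_neq0.
  - by move: sz => /=; rewrite addn2 addn3.
case/lastP: t => [|t cp]
  in sz g n0 tn sp s0 nz D0 d dt dD T Tt S after before *.
  by right=> c; rewrite inE => /eqP ->.
have cpt : cp \in c1 :: rcons t cp by rewrite inE mem_rcons mem_head orbT.
(* Likewise, if [cp] lies in the plane, [before] puts [a] in the cone of its cyclic neighbours [cp]
   and [b]. *)
have := D0 cp cpt; rewrite le_eqVlt => /orP[/eqP/esym cp0 | cpp].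
  left; have sub : subseq [:: c1; cp] (c1 :: rcons t cp).
    by rewrite /= eqxx sub1seq mem_rcons mem_head.
  have [A0 B0] := S _ _ sub; have E := before _ _ cp0 sub.
  have B1 : 0 < det3 b c1 cp.
    have := congr1 (@coordsum R) E; rewrite coordsumD !coordsumZ => E'.
    rewrite -(pmulr_lgt0 _ Ta) -E' ltr_pwDl ?mulr_ge0 ?(ltW Tb) //.
    by rewrite mulr_gt0 // Tt.
  rewrite -!rcons_cons -cats1 in g *.
  apply: reach_trans (reach_rot [:: cp] _).
  apply: (@reach_of_cone (det3 a b c1 / det3 b c1 cp)
                         (det3 a c1 cp / det3 b c1 cp)) => //.
  - by rewrite divr_ge0 // ltW.
  - by rewrite divr_ge0.
  - rewrite ![_ / det3 b c1 cp]mulrC -!scalerA -scalerDr E scalerA.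
    by rewrite mulVf ?scale1r // lt0r_neq0.
  - by move: sz; rewrite /= size_rcons addn2 addn3.
  - exact: good_rot g.
right=> z zt; have := D0 z zt; rewrite le_eqVlt => /orP[/eqP/esym z0|//].
move: zt; rewrite inE mem_rcons inE => /or3P[/eqP ez|/eqP ez|zt].
- by rewrite ez in z0; rewrite z0 ltxx in c1p.
- by rewrite ez in z0; rewrite z0 ltxx in cpp.
have sub1 : subseq [:: c1; z] (c1 :: rcons t cp).
  by rewrite /= eqxx sub1seq mem_rcons inE zt orbT.
have sub2 : subseq [:: z; cp] (c1 :: rcons t cp).
  apply: subseq_trans (subseq_cons _ _).
  by rewrite -cats1 -(cat1s z) cat_subseq // sub1seq.
have [A1 B1] := S _ _ sub1; have [A2 B2] := S _ _ sub2.
have E1 := before _ _ z0 sub1; have E2 := after _ _ z0 sub2.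
(* Applying [det3 b c1] to [E2] gives two nonnegative products with sum 0, whence [det3 b c1 z = 0].
   Then [E1] makes a positive multiple of [z] plus a nonnegative multiple of [b] vanish, which
   coordinate sums forbid. *)
have F : det3 a b cp * det3 b c1 z + det3 b z cp * det3 a b c1 = 0.
  have := congr1 (fun v => det3 b c1 v) E2.
  rewrite (_ : det3 b c1 (det3 a z cp *: b) = 0); last first.
    by rewrite /det3 !mxE; ring.
  by rewrite /det3 !mxE => <-; ring.
have B10 : det3 b c1 z = 0.
  apply/eqP; have G1 := mulr_ge0 B2 (ltW c1p); have G2 := mulr_ge0 (ltW cpp) B1.
  have : det3 a b cp * det3 b c1 z = 0 by lra.
  by move/eqP; rewrite mulf_eq0 gt_eqF.
have := congr1 (@coordsum R) E1; rewrite coordsumD !coordsumZ B10 mul0r.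
have := mulr_ge0 A1 (ltW Tb); have : 0 < det3 a b c1 * coordsum z.
  by rewrite mulr_gt0 // Tt // inE mem_rcons inE zt !orbT.
lra.
Qed.

End Dichotomy.

End Reduction.

(** * Placing the columns one by one along a polygonal path *)

Section Fan.
Variable R : realType.
Implicit Types (a b c q u v w z : 'cV[R]_3) (r s t x y : seq 'cV[R]_3).

(** A discrete intermediate value theorem, used to find the edge by which the ray leaves the
    path. *)
Lemma split_sign_change (T : eqType) (p : pred T) (a : T) (y : seq T) :
  p a -> ~~ p (last a y) ->
  exists (l : seq T) (u v : T) (r : seq T),
    [/\ a :: y = l ++ [:: u, v & r], p u & ~~ p v].
Proof.
elim: y a => [|b y IHy] a pa; first by rewrite /= pa.
rewrite /=; have [pb /(IHy _ pb)|pb _] := boolP (p b).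
  by case=> l [u [v [r [-> pu pv]]]]; exists (a :: l), u, v, r.
by exists [::], a, b, y.
Qed.

(** Induction on [t]: [s] holds the columns already placed, and [x] the interior vertices of the
    current path from [a] to [z]. Strictness puts [z] strictly left of each ray to be followed, so
    the path must cross it. *)
Lemma reach_fan z t s a x :
  {in [:: a, z & x ++ t], forall v, nonneg v} ->
  {in rcons x z, forall v, v != 0} ->
  {in t, forall c, path (fun u v => 0 <= det3 u v c) a (rcons x z)} ->
  path (fun u v => 0 < det3 u v z) a t -> tnn (a :: t) ->
  reach (s ++ a :: rcons x z) (s ++ a :: rcons t z).
Proof.
elim: t s a x => [|b t IHt] s a x n0 nz hp.
  by move=> _ _; have := reach_del_cat (rcons s a) x [::] z;
     rewrite !cat_rcons cats1.
move=> /= /andP[abz tz] tn.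
have a0 : nonneg a by apply: n0; rewrite inE eqxx.
have z0 : nonneg z by apply: n0; rewrite !inE eqxx orbT.
have b0 : nonneg b by apply: n0; rewrite !inE mem_cat inE eqxx !orbT.
(* The predicate says that [w] is not left of the ray from [a] through [b]: it holds at [a] and
   fails at [z]. *)
have [|| l [u [v [r [ey fu fv]]]]] :=
    @split_sign_change _ (fun w => 0 <= det3 a w b) a (rcons x z).
- by rewrite (_ : det3 a a b = 0) // /det3; ring.
- by rewrite last_rcons -ltNge -det3C det3N det3C oppr_lt0.
rewrite -ltNge in fv.
have xn0 w : w \in rcons x z -> nonneg w.
  move=> wx; apply: n0; move: wx; rewrite mem_rcons !inE mem_cat.
  by case/orP=> ->; rewrite ?orbT.
have yn0 w : w \in a :: rcons x z -> nonneg w.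
  by rewrite inE => /orP[/eqP -> //|/xn0].
have u0 : nonneg u by apply: yn0; rewrite ey mem_cat mem_head orbT.
have v0 : nonneg v by apply: yn0; rewrite ey mem_cat !inE eqxx !orbT.
have abv : 0 < det3 a b v by rewrite -det3C det3N det3C oppr_gt0.
have bt : b \in b :: t by rewrite mem_head.
have uvP c : c \in b :: t -> 0 <= det3 u v c.
  move=> ct; have : sorted (fun u v => 0 <= det3 u v c) (a :: rcons x z).
    exact: hp.
  by rewrite ey; case: (l) => [|? ?] /=; rewrite ?cat_path /=;
     [case/andP | case/and4P].
(* If the crossed edge began at [a], then [b] would lie strictly to its right, against [uvP]. *)
case: l => [|a' l] in ey; case: ey.
  by move=> ea _; move: fv; rewrite ltNge ea uvP.
move=> _ {a'} ey.
have un0 : u != 0 by apply: nz; rewrite ey mem_cat mem_head orbT.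
(* The coefficients on the right are nonnegative and that of [u] is positive, so coordinate sums
   give [det3 a u v > 0]. *)
have Cr := cramer3 a u v b.
rewrite -[det3 b u v]det3C in Cr.
have Dp : 0 < det3 a u v.
  have := congr1 (@coordsum R) Cr; rewrite !coordsumD !coordsumZ.
  have := mulr_ge0 (uvP b bt) (coordsum_ge0 a0).
  have := mulr_gt0 abv (coordsum_gt0 u0 un0).
  have := mulr_ge0 fu (coordsum_ge0 v0) => h1 h2 h3 h4.
  have h : 0 < det3 a u v * coordsum b by lra.
  have Tb : 0 < coordsum b.
    rewrite lt_neqAle coordsum_ge0 // andbT; apply/eqP => T0.
    by rewrite -T0 mulr0 ltxx in h.
  by rewrite pmulr_lgt0 in h.
pose la := det3 u v b / det3 a u v.
pose al := det3 a b v / det3 a u v.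
pose be := det3 a u b / det3 a u v.
have la0 : 0 <= la by rewrite divr_ge0 ?uvP // ltW.
have al0 : 0 < al by rewrite divr_gt0.
have be0 : 0 <= be by rewrite divr_ge0 // ltW.
(* The exit point of the ray on the edge from [u] to [v], scaled so that [b = la *: a + q]. *)
pose q := al *: u + be *: v.
have eb : b = la *: a + 1 *: q.
  rewrite scale1r /q addrA /la /al /be ![_ / det3 a u v]mulrC -!scalerA.
  by rewrite -!scalerDr -Cr scalerA mulVf ?scale1r // lt0r_neq0.
have [x' ex] : exists x', v :: r = rcons x' z.
  case/lastP: r ey => [|r z'] ey.
    move/(congr1 (last z)): ey; rewrite last_rcons last_cat /= => <-.
    by exists [::].
  move/(congr1 (last z)): ey; rewrite last_rcons last_cat /= last_rcons => <-.
  by exists (v :: r).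
have x'x w : w \in v :: r -> w \in rcons x z.
  by rewrite ey mem_cat !inE => /orP[]->; rewrite !orbT.
have q0 : nonneg q by apply: nonneg_cone => //; apply: ltW.
have H := IHt (rcons s a) b (q :: x').
apply: (@reach_trans _ _ (rcons s a ++ b :: rcons (q :: x') z)); last first.
  rewrite -(cat_rcons a); apply: H => //.
  - move=> w; rewrite !inE mem_cat => /or4P[/eqP->|/eqP->|/eqP->|] //.
    case/orP => wt.
      by apply: xn0; apply: x'x; rewrite ex mem_rcons inE wt orbT.
    by apply: n0; rewrite !inE mem_cat inE wt !orbT.
  - move=> w; rewrite rcons_cons -ex inE => /orP[/eqP->|/x'x/nz //].
    apply: contraTneq (coordsum_gt0 u0 un0) => q0'.
    have := congr1 (@coordsum R) q0'.
    rewrite coordsumD !coordsumZ /coordsum !mxE !addr0.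
    rewrite -!/(coordsum _) => E.
    have := mulr_ge0 be0 (coordsum_ge0 v0) => h1.
    rewrite -leNgt -(pmulr_rle0 _ al0); lra.
  (* The edge from [b] to [q] runs along the line through [a] and [b], the edge from [q] to [v]
     along the old edge from [u] to [v]; the remaining edges are unchanged. *)
  - move=> c ct; have cbt : c \in b :: t by rewrite inE ct orbT.
    rewrite rcons_cons -ex /=; apply/and3P; split.
    + have -> : det3 b q c = la * det3 a b c.
        by rewrite {1}eb [in RHS]eb /det3 !mxE; ring.
      by rewrite mulr_ge0 //; apply: tn; rewrite /= !eqxx sub1seq.
    + have -> : det3 q v c = al * det3 u v c.
        by rewrite /q /det3 !mxE; ring.
      by rewrite mulr_ge0 ?uvP // ltW.
    + by have := hp c cbt; rewrite ey cat_path /= => /and4P[].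
  - exact: tnn_subseq (subseq_cons _ _) tn.
(* Drop the vertices between [a] and [u], insert [q] after [u], drop [u], then insert [b] between
   [a] and [q]. *)
rewrite rcons_cons -ex ey cat_rcons.
apply: (@reach_trans _ _ (s ++ [:: a, u, v & r])).
  by have := reach_del_cat (rcons s a) l (v :: r) u; rewrite !cat_rcons.
apply: (@reach_trans _ _ (s ++ [:: a, u, q, v & r])).
  by have := reach_insert (rcons s a) r u v (ltW al0) be0; rewrite !cat_rcons.
apply: (@reach_trans _ _ (s ++ [:: a, q, v & r])).
  by have := reach_dell (rcons s a) (v :: r) u q; rewrite !cat_rcons.
by rewrite eb; apply: reach_insert.
Qed.

End Fan.

(** * Cutting the triangle by the line through the last and first columns *)

Section Cut.
Variable R : realType.
Implicit Types (c e f g u v : 'cV[R]_3) (s x : seq 'cV[R]_3).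

Definition comb e f g (k1 k2 k3 : R) : 'cV[R]_3 :=
  k1 *: e + k2 *: f + k3 *: g.

Lemma det3_comb e f g (a1 a2 a3 b1 b2 b3 c1 c2 c3 : R) :
  det3 (comb e f g a1 a2 a3) (comb e f g b1 b2 b3) (comb e f g c1 c2 c3) =
  ((a2 * b3 - a3 * b2) * c1 + (a3 * b1 - a1 * b3) * c2
   + (a1 * b2 - a2 * b1) * c3) * det3 e f g.
Proof. by rewrite /comb /det3 !mxE; ring. Qed.

(** What [reach_fan] requires of its initial path from [y] to [z]. *)
Definition fan_start (base t : seq 'cV[R]_3) (y z : 'cV[R]_3) :=
  exists x, [/\ reach base (y :: rcons x z),
    {in x, forall v, nonneg v}, {in x, forall v, v != 0} &
    {in t, forall c, path (fun u v => 0 <= det3 u v c) y (rcons x z)}].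

Section Corner.
Variables (e f g : 'cV[R]_3) (t : seq 'cV[R]_3).
Hypothesis efg : det3 e f g = 1.
Hypotheses (e_ge0 : nonneg e) (f_ge0 : nonneg f) (g_ge0 : nonneg g).
Hypothesis t_comb : {in t, forall c, exists k1 k2 k3,
  [/\ 0 <= k1, 0 <= k2, 0 <= k3 & c = comb e f g k1 k2 k3]}.
Variables (y1 y2 y3 z1 z2 z3 : R).
Hypotheses (y1_ge0 : 0 <= y1) (y2_ge0 : 0 <= y2) (y3_ge0 : 0 <= y3).
Hypotheses (z1_ge0 : 0 <= z1) (z2_ge0 : 0 <= z2) (z3_ge0 : 0 <= z3).
Let y := comb e f g y1 y2 y3.
Let z := comb e f g z1 z2 z3.
Hypothesis t_side : {in t, forall c, 0 <= det3 z y c}.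

(** The values of [det3 z y] at the corners [e], [f], [g]; their signs tell on which side of the
    line through [z] and [y] each corner lies. *)
Let le := z2 * y3 - z3 * y2.
Let lf := z3 * y1 - z1 * y3.
Let lg := z1 * y2 - z2 * y1.

(** The point where that line meets the side [e], [g]. It equals [z2 *: y - y2 *: z], the source of
    [y_cone] and of the first part of [path_yq]. *)
Let q := comb e f g (- lg) 0 le.

Let comb_ge0 k1 k2 k3 : 0 <= k1 -> 0 <= k2 -> 0 <= k3 ->
  nonneg (comb e f g k1 k2 k3).
Proof.
by move=> *; rewrite /comb => i; rewrite !mxE !addr_ge0 ?mulr_ge0.
Qed.

Let comb_neq0 k1 k2 k3 : [|| k1 != 0, k2 != 0 | k3 != 0] ->
  comb e f g k1 k2 k3 != 0.
Proof.
apply: contraTneq => E.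
have : det3 (comb e f g k1 k2 k3) f g = k1 * det3 e f g.
  by rewrite /comb /det3 !mxE; ring.
have : det3 e (comb e f g k1 k2 k3) g = k2 * det3 e f g.
  by rewrite /comb /det3 !mxE; ring.
have : det3 e f (comb e f g k1 k2 k3) = k3 * det3 e f g.
  by rewrite /comb /det3 !mxE; ring.
rewrite E efg !mulr1 /det3 !mxE !mulr0 !mul0r !subrr !mul0r !addr0.
by move=> <- <- <-; rewrite eqxx.
Qed.

Let e_neq0 : e != 0.
Proof.
have -> : e = comb e f g 1 0 0 by rewrite /comb scale1r !scale0r !addr0.
by apply: comb_neq0; rewrite oner_neq0.
Qed.

Let f_neq0 : f != 0.
Proof.
have -> : f = comb e f g 0 1 0 by rewrite /comb scale1r !scale0r add0r addr0.
by apply: comb_neq0; rewrite oner_neq0 orbT.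
Qed.

Let side_gt0 : 0 < le -> 0 < z2.
Proof.
move=> le0; rewrite lt_neqAle z2_ge0 andbT; apply/eqP => z20.
by move: le0; rewrite /le -z20 mul0r sub0r oppr_gt0 ltNge mulr_ge0.
Qed.

Let y_cone : 0 < le -> y = (y2 / z2) *: z + z2^-1 *: q.
Proof.
move=> /side_gt0 /lt0r_neq0 z20.
by apply: col3P; rewrite /y /z /q /le /lg /comb !mxE; field.
Qed.

Let path_yq c : c \in t -> 0 < le -> 0 <= det3 y q c /\ 0 <= det3 q e c.
Proof.
move=> ct le0; have [k1 [k2 [k3 [k10 k20 k30 ec]]]] := t_comb ct; split.
  rewrite (_ : det3 y q c = y2 * det3 z y c) ?mulr_ge0 ?t_side //.
  by rewrite ec !det3_comb /le /lg; ring.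
rewrite (_ : det3 q e c = le * k2 * det3 e f g).
  by rewrite efg mulr1 mulr_ge0 // ltW.
by rewrite ec /q /comb /det3 !mxE; ring.
Qed.

(** Only [e] is strictly on the side of [t]: the line cuts off the triangle [q], [e], [p], where
    [p = y3 *: z - z3 *: y] lies on the side [e], [f], and the path is [y], [q], [e], [p], [z]. *)
Lemma fan_start_corner1 : 0 < le -> lf <= 0 -> lg <= 0 ->
  fan_start [:: e; f; g] t y z.
Proof.
move=> le0 lf0 lg0; have z20 := side_gt0 le0; have ley := lt0r_neq0 le0.
have lf0' : 0 <= - lf by rewrite oppr_ge0.
have lg0' : 0 <= - lg by rewrite oppr_ge0.
pose p := comb e f g (- lf) le 0.
have zE : z = (z2 / le) *: p + (z3 / le) *: q.
  by apply: col3P; rewrite /z /q /p /lf /lg /comb !mxE; move: ley;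
     rewrite /le => ?; field.
have pz c : c \in t -> det3 p z c = z3 * det3 z y c.
  move=> /t_comb[k1 [k2 [k3 [_ _ _ ->]]]].
  by rewrite !det3_comb /le /lf; ring.
have ep c : c \in t -> 0 <= det3 e p c.
  move=> /t_comb[k1 [k2 [k3 [_ _ k30 ->]]]].
  rewrite (_ : det3 e p _ = le * k3 * det3 e f g).
    by rewrite efg mulr1 mulr_ge0 // ltW.
  by rewrite /p /comb /det3 !mxE; ring.
exists [:: q; e; p]; split.
- apply: (@reach_trans _ _ [:: e; p; f; g]).
    have -> : p = (- lf) *: e + le *: f by rewrite /p /comb scale0r addr0.
    by apply: (reach_insert [::]) => //; apply: ltW.
  apply: (reach_trans (reach_delr [:: e] [:: g] p f)).
  apply: (reach_trans (reach_rot [:: e] [:: p; g])) => /=.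
  apply: (@reach_trans _ _ [:: p; g; q; e]).
    have -> : q = le *: g + (- lg) *: e by rewrite /q /comb scale0r addr0 addrC.
    by apply: (reach_insert [:: p]) => //; apply: ltW.
  apply: (reach_trans (reach_dell [:: p] [:: e] g q)) => /=.
  apply: (@reach_trans _ _ [:: p; z; q; e]).
    by rewrite zE; apply: (reach_insert [::]); rewrite divr_ge0 // ltW.
  apply: (@reach_trans _ _ [:: p; z; y; q; e]).
    rewrite [in X in reach _ X](y_cone le0).
    by apply: (reach_insert [:: p]); rewrite ?divr_ge0 ?invr_ge0 // ltW.
  exact: (reach_rot [:: p; z]).
- move=> v; rewrite !inE => /or3P[] /eqP -> //.
    by apply: comb_ge0 => //; apply: ltW.
  by apply: comb_ge0 => //; apply: ltW.
- move=> v; rewrite !inE => /or3P[] /eqP ->.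
  + by apply: comb_neq0; rewrite ley !orbT.
  + by apply: e_neq0.
  + by apply: comb_neq0; rewrite ley !orbT.
- move=> c ct /=; have [yq qe] := path_yq ct le0.
  by rewrite yq qe ep // pz // mulr_ge0 ?t_side.
Qed.

(** Both [e] and [f] are strictly on the side of [t]: the piece cut off is the quadrilateral [q],
    [e], [f], [p], where [p = y1 *: z - z1 *: y] lies on the side [f], [g]. *)
Lemma fan_start_corner2 : 0 < le -> 0 < lf -> lg <= 0 ->
  fan_start [:: e; f; g] t y z.
Proof.
move=> le0 lf0 lg0; have z20 := side_gt0 le0.
(* Since [det3 z y z = 0], [le * z1 + lf * z2 + lg * z3 = 0]; with [lg = 0] the left side would be
   positive. *)
have lg1 : 0 < - lg.
  rewrite oppr_gt0 lt_neqAle lg0 andbT; apply/eqP => lgE.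
  have h : le * z1 + lf * z2 = 0.
    by have -> : le * z1 + lf * z2 = - lg * z3; [rewrite /le /lf /lg; ring |
       rewrite lgE oppr0 mul0r].
  have := mulr_ge0 (ltW le0) z1_ge0; have := mulr_gt0 lf0 z20; lra.
have ln0 := lt0r_neq0 lg1.
pose p := comb e f g 0 (- lg) lf.
have zE : z = (z2 / - lg) *: p + (z1 / - lg) *: q.
  by apply: col3P; rewrite /z /q /p /lf /le /comb !mxE; move: ln0;
     rewrite /lg => ?; field => //; rewrite -oppr_eq0.
have pz c : c \in t -> det3 p z c = z1 * det3 z y c.
  move=> /t_comb[k1 [k2 [k3 [_ _ _ ->]]]].
  by rewrite !det3_comb /lg /lf; ring.
have ef c : c \in t -> 0 <= det3 e f c.
  move=> /t_comb[k1 [k2 [k3 [_ _ k30 ->]]]].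
  rewrite (_ : det3 e f _ = k3 * det3 e f g); first by rewrite efg mulr1.
  by rewrite /comb /det3 !mxE; ring.
have fp c : c \in t -> 0 <= det3 f p c.
  move=> /t_comb[k1 [k2 [k3 [k10 _ _ ->]]]].
  rewrite (_ : det3 f p _ = lf * k1 * det3 e f g).
    by rewrite efg mulr1 mulr_ge0 // ltW.
  by rewrite /p /comb /det3 !mxE; ring.
exists [:: q; e; f; p]; split.
- apply: (@reach_trans _ _ [:: e; f; p; g]).
    have -> : p = (- lg) *: f + lf *: g by rewrite /p /comb scale0r add0r.
    by apply: (reach_insert [:: e]) => //; apply: ltW.
  apply: (reach_trans (reach_rot [:: e] _)) => /=.
  apply: (@reach_trans _ _ [:: f; p; g; q; e]).
    have -> : q = le *: g + (- lg) *: e by rewrite /q /comb scale0r addr0 addrC.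
    by apply: (reach_insert [:: f; p]) => //; apply: ltW.
  apply: (reach_trans (reach_dell [:: f; p] [:: e] g q)) => /=.
  apply: (reach_trans (reach_rot [:: f] _)) => /=.
  apply: (@reach_trans _ _ [:: p; z; q; e; f]).
    by rewrite zE; apply: (reach_insert [::]); rewrite divr_ge0 // ltW.
  apply: (@reach_trans _ _ [:: p; z; y; q; e; f]).
    rewrite [in X in reach _ X](y_cone le0).
    by apply: (reach_insert [:: p]); rewrite ?divr_ge0 ?invr_ge0 // ltW.
  exact: (reach_rot [:: p; z]).
- move=> v; rewrite !inE => /or4P[] /eqP -> //.
    by apply: comb_ge0 => //; apply: ltW.
  by apply: comb_ge0 => //; apply: ltW.
- move=> v; rewrite !inE => /or4P[] /eqP ->.
  + by apply: comb_neq0; rewrite ln0.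
  + exact: e_neq0.
  + exact: f_neq0.
  + by apply: comb_neq0; rewrite ln0 orbT.
- move=> c ct /=; have [yq qe] := path_yq ct le0.
  by rewrite yq qe ef // fp // pz // mulr_ge0 ?t_side.
Qed.

End Corner.
End Cut.

(** * The construction from the identity, and the passage from matrices to sequences *)

Section Construction.
Variable R : realType.
Implicit Types (c e f g u v y z : 'cV[R]_3) (s t x : seq 'cV[R]_3).

Let E0 : 'cV[R]_3 := delta_mx 0 0.
Let E1 : 'cV[R]_3 := delta_mx 1 0.
Let E2 : 'cV[R]_3 := delta_mx 2 0.

Lemma cols1 : cols (1%:M : 'M[R]_3) = [:: E0; E1; E2].
Proof.
have e3 : enum 'I_3 = [:: 0; 1; 2].
  by apply: (inj_map val_inj); rewrite val_enum_ord.
by rewrite /cols e3 /= /E0 /E1 /E2; congr [:: _; _; _]; apply/matrixP => i j;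
   rewrite !mxE ord1 andbT.
Qed.

Let delta_ge0 i : nonneg (delta_mx i 0 : 'cV[R]_3).
Proof. by move=> j; rewrite mxE ler0n. Qed.

Let combE v : [/\ v = comb E0 E1 E2 (v 0 0) (v 1 0) (v 2 0),
  v = comb E1 E2 E0 (v 1 0) (v 2 0) (v 0 0) &
  v = comb E2 E0 E1 (v 2 0) (v 0 0) (v 1 0)].
Proof. by split; apply: col3P; rewrite /comb !mxE /=; ring. Qed.

Let detE : [/\ det3 E0 E1 E2 = 1, det3 E1 E2 E0 = 1 & det3 E2 E0 E1 = 1].
Proof. by split; rewrite /det3 !mxE /=; ring. Qed.

(** Case analysis on the signs of [det3 z y] at the unit vectors. All positive would force [z = 0],
    none positive contradicts the strict column [c], and the other six cases are the two corner
    lemmas up to rotation. *)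
Lemma fan_start_unit t y z : {in [:: y, z & t], forall v, nonneg v} ->
  {in t, forall c, 0 <= det3 z y c} -> (exists2 c, c \in t & 0 < det3 z y c) ->
  fan_start [:: E0; E1; E2] t y z.
Proof.
move=> n0 side [c ct cp].
have y0 : nonneg y by apply: n0; rewrite inE eqxx.
have z0 : nonneg z by apply: n0; rewrite !inE eqxx orbT.
have t0 v : v \in t -> nonneg v by move=> vt; apply: n0; rewrite !inE vt !orbT.
have [d0 d1 d2] := detE.
pose l0 := z 1 0 * y 2 0 - z 2 0 * y 1 0.
pose l1 := z 2 0 * y 0 0 - z 0 0 * y 2 0.
pose l2 := z 0 0 * y 1 0 - z 1 0 * y 0 0.
have cE : det3 z y c = l0 * c 0 0 + l1 * c 1 0 + l2 * c 2 0 by [].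
have [c00 c10 c20] : [/\ 0 <= c 0 0, 0 <= c 1 0 & 0 <= c 2 0].
  by split; apply: t0.
have zE : l0 * z 0 0 + l1 * z 1 0 + l2 * z 2 0 = 0.
  by rewrite /l0 /l1 /l2; ring.
have zn0 : z != 0.
  by apply: contraTneq cp => ->;
     rewrite /det3 !mxE !mul0r !subrr !mul0r !addr0 ltxx.
have not_all_pos (k0 k1 k2 : R) : 0 < k0 -> 0 < k1 -> 0 < k2 ->
    k0 * z 0 0 + k1 * z 1 0 + k2 * z 2 0 = 0 -> False.
  move=> k00 k10 k20 E; case/eqP: zn0.
  have h0 := mulr_ge0 (ltW k00) (z0 0); have h1 := mulr_ge0 (ltW k10) (z0 1).
  have h2 := mulr_ge0 (ltW k20) (z0 2).
  by apply: col3P; rewrite mxE; [apply: (mulfI (lt0r_neq0 k00)) |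
    apply: (mulfI (lt0r_neq0 k10)) | apply: (mulfI (lt0r_neq0 k20))];
    rewrite mulr0; lra.
have yz (e f g : 'cV[R]_3) i j k : y = comb e f g (y i 0) (y j 0) (y k 0) ->
    z = comb e f g (z i 0) (z j 0) (z k 0) ->
    {in t, forall c, 0 <= det3 (comb e f g (z i 0) (z j 0) (z k 0))
                     (comb e f g (y i 0) (y j 0) (y k 0)) c}.
  by move=> <- <-.
have [yE0 yE1 yE2] := combE y; have [zE0 zE1 zE2] := combE z.
have b0 := reach_refl [:: E0; E1; E2].
have b1 : reach [:: E0; E1; E2] [:: E1; E2; E0].
  exact: (reach_rot [:: E0]).
have b2 : reach [:: E0; E1; E2] [:: E2; E0; E1].
  exact: (reach_rot [:: E0; E1]).
have start base : reach [:: E0; E1; E2] base -> fan_start base t y z ->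
    fan_start [:: E0; E1; E2] t y z.
  move=> b [x [rx x0 xn xp]]; exists x; split => //.
  exact: reach_trans b rx.
have tc0 : {in t, forall v, exists k1 k2 k3, [/\ 0 <= k1, 0 <= k2, 0 <= k3 &
    v = comb E0 E1 E2 k1 k2 k3]}.
  move=> v /t0 v0; exists (v 0 0), (v 1 0), (v 2 0).
  by have [e _ _] := combE v; split.
have tc1 : {in t, forall v, exists k1 k2 k3, [/\ 0 <= k1, 0 <= k2, 0 <= k3 &
    v = comb E1 E2 E0 k1 k2 k3]}.
  move=> v /t0 v0; exists (v 1 0), (v 2 0), (v 0 0).
  by have [_ e _] := combE v; split.
have tc2 : {in t, forall v, exists k1 k2 k3, [/\ 0 <= k1, 0 <= k2, 0 <= k3 &
    v = comb E2 E0 E1 k1 k2 k3]}.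
  move=> v /t0 v0; exists (v 2 0), (v 0 0), (v 1 0).
  by have [_ _ e] := combE v; split.
have [p0|n0'] := ltP 0 l0; have [p1|n1] := ltP 0 l1; have [p2|n2] := ltP 0 l2.
- by case: (not_all_pos _ _ _ p0 p1 p2 zE).
- apply: (start _ b0); rewrite yE0 zE0.
  by apply: fan_start_corner2 => //;
     first [exact: y0 | exact: z0 | exact: yz | exact: delta_ge0].
- apply: (start _ b2); rewrite yE2 zE2.
  by apply: fan_start_corner2 => //;
     first [exact: y0 | exact: z0 | exact: yz | exact: delta_ge0].
- apply: (start _ b0); rewrite yE0 zE0.
  by apply: fan_start_corner1 => //;
     first [exact: y0 | exact: z0 | exact: yz | exact: delta_ge0].
- apply: (start _ b1); rewrite yE1 zE1.
  by apply: fan_start_corner2 => //;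
     first [exact: y0 | exact: z0 | exact: yz | exact: delta_ge0].
- apply: (start _ b1); rewrite yE1 zE1.
  by apply: fan_start_corner1 => //;
     first [exact: y0 | exact: z0 | exact: yz | exact: delta_ge0].
- apply: (start _ b2); rewrite yE2 zE2.
  by apply: fan_start_corner1 => //;
     first [exact: y0 | exact: z0 | exact: yz | exact: delta_ge0].
- exfalso; have := mulr_le0_ge0 n0' c00; have := mulr_le0_ge0 n1 c10.
  have := mulr_le0_ge0 n2 c20; move: cp; rewrite cE => cp h2 h1 h0.
  by have := ler_wnDr h2 (ler_wnDr h1 h0); rewrite leNgt cp.
Qed.

Lemma path_of_splits (T : eqType) (r : rel T) (a : T) (p : seq T) :
  (forall (l : seq T) (u v : T) (q : seq T),
    a :: p = l ++ [:: u, v & q] -> r u v) -> path r a p.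
Proof.
elim: p a => //= b p IHp a H; rewrite (H [::] a b p) //=.
by apply: IHp => l u v q E; apply: (H (a :: l) u v q); rewrite E.
Qed.

Lemma good_reach s : good s -> reach [:: E0; E1; E2] s.
Proof.
elim: {s}(size s).+1 {-2}s (ltnSn (size s)) => // n IHn s sn g.
have IH s' : (size s' < size s)%N -> good s' -> reach [:: E0; E1; E2] s'.
  by move=> s's; apply: IHn; apply: leq_trans s's _.
(* If [s] were unreachable, [reach_or_strict] applied to its rotations would make every cyclically
   consecutive pair strict; these inequalities feed the direct construction below. *)
have [//|nr] := EM (reach [:: E0; E1; E2] s).
have strict s1 s2 a b t : s = s1 ++ s2 -> s2 ++ s1 = [:: a, b & t] ->
    {in t, forall c, 0 < det3 a b c}.
  move=> es et; have gt : good [:: a, b & t].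
    by rewrite -et; apply: good_rot; rewrite -es.
  have st : (size t + 2 <= size s)%N.
    by rewrite es size_cat (addnC (size s1)) -size_cat et addn2.
  have [r|//] := reach_or_strict IH st gt; case: nr; rewrite es.
  by apply: reach_trans (reach_rot s2 s1); rewrite et.
have sn0 v : v \in s -> v != 0.
  by move=> vs; apply: contra_not_neq nr => v0; apply: (reach_of_zero IH) => //;
     rewrite -v0.
have [n0 tn sp] := g; have := spanning_size sp.
case: s => [//|y s] in sn g {IH sp} nr strict sn0 n0 tn *.
case/lastP: s => [//|t z] in sn g nr strict sn0 n0 tn *.
rewrite /= size_rcons !ltnS => t1.
have side : {in t, forall c, 0 < det3 z y c}.
  by apply: (strict (y :: t) [:: z]) => //; rewrite /= cats1.
have tn0 : {in [:: y, z & t], forall v, nonneg v}.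
  move=> v; rewrite !inE => H; apply: n0; rewrite inE mem_rcons inE.
  by move: H; rewrite orbA.
have [x [rx x0 xn xp]] : fan_start [:: E0; E1; E2] t y z.
  apply: fan_start_unit => //; first by move=> c /side/ltW.
  case: t t1 side {sn g nr strict sn0 n0 tn tn0} => // c t _ side.
  by exists c; rewrite ?mem_head //; apply: side; rewrite mem_head.
apply: (reach_trans rx); apply: (@reach_fan _ z t [::]) => //.
- move=> v; rewrite !inE mem_cat => /or4P[vy|vz|/x0 //|vt]; apply: tn0.
  + by rewrite inE vy.
  + by rewrite !inE vz orbT.
  + by rewrite !inE vt !orbT.
- move=> v; rewrite mem_rcons inE => /orP[/eqP->|/xn //].
  by apply: sn0; rewrite inE mem_rcons mem_head orbT.
- apply: path_of_splits => l u v q E.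
  apply: (strict l [:: u, v & rcons q z] u v (rcons q z ++ l)) => //.
    by rewrite -rcons_cons E rcons_cat.
  by rewrite mem_cat mem_rcons mem_head.
- by apply: tnn_subseq tn; rewrite -rcons_cons; apply: subseq_rcons.
Qed.

(** Increasing maps from ['I_3] correspond to three-term subsequences of [enum 'I_n], because that
    enumeration is strictly sorted. *)
Lemma minors3_tnn n (M : 'M[R]_(3, n)) : minors3_nonneg M <-> tnn (cols M).
Proof.
have srt : sorted (fun i j : 'I_n => (i < j)%N) (enum 'I_n).
  have := iota_ltn_sorted 0 n; rewrite -val_enum_ord.
  by rewrite sorted_map.
have tr : transitive (fun i j : 'I_n => (i < j)%N).
  by move=> ? ? ?; apply: ltn_trans.
split=> [H u v w | H f fi].
  move=> /subseqP[m _]; rewrite /cols -map_mask => E.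
  have := mask_subseq m (enum 'I_n).
  case: (mask m _) E => [|i [|j [|k [|]]]] //.
  case=> -> -> -> /(subseq_sorted tr)/(_ srt) /= /and3P[ij jk _].
  pose f (a : 'I_3) : 'I_n := nth i [:: i; j; k] a.
  have := H f; rewrite det_colsub; apply.
  move=> [[|[|[|//]]] ?] [[|[|[|//]]] ?] //= _.
  exact: ltn_trans jk.
rewrite det_colsub; apply: H.
have -> : [:: col (f 0) M; col (f 1) M; col (f 2) M] =
  [seq col j M | j <- [:: f 0; f 1; f 2]] by [].
apply: map_subseq.
(* Both lists are strictly sorted with the same elements, hence equal. *)
have -> : [:: f 0; f 1; f 2] = [seq i <- enum 'I_n | i \in [:: f 0; f 1; f 2]].
  apply: (irr_sorted_eq tr) => //.
  - by move=> i; rewrite ltnn.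
  - by rewrite /= !fi.
  - exact: sorted_filter.
  - by move=> i; rewrite mem_filter mem_enum andbT.
exact: filter_subseq.
Qed.

Lemma cols_nonneg n (M : 'M[R]_(3, n)) : (forall i j, 0 <= M i j) ->
  {in cols M, forall v, nonneg v}.
Proof. by move=> M0 v /mapP[j _ ->] i; rewrite mxE. Qed.

(** A rank 3 matrix with three rows is row free, so a functional that vanishes on its columns is
    zero. *)
Lemma cols_spanning n (M : 'M[R]_(3, n)) : \rank M = 3%N -> spanning (cols M).
Proof.
move=> rM f H; apply/eqP; rewrite -(@mulmx_free_eq0 _ _ _ _ _ M); last first.
  by rewrite /row_free rM.
apply/eqP/matrixP => i j.
have /H/matrixP/(_ i 0) : col j M \in cols M by apply: map_f; rewrite mem_enum.
by rewrite !mxE => fM; rewrite -[RHS]fM; apply: eq_bigr => k _; rewrite mxE.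
Qed.

Lemma tnn_cols1 : tnn (cols (1%:M : 'M[R]_3)).
Proof.
rewrite cols1 => u v w /size_subseq_leqif H.
have /esym/eqP[-> -> ->] := H.2; have [-> _ _] := detE; exact: ler01.
Qed.

End Construction.

Theorem theorem5p8 (R : realType) (n : nat) (M : 'M[R]_(3, n))
    (M_ge0 : forall (i : 'I_3) (j : 'I_n), 0 <= M i j)
    (rankM : \rank M = 3%N) :
  minors3_nonneg M <-> constructible_from (1%:M : 'M[R]_3) M.
Proof.
split=> [/minors3_tnn tM | cM].
  rewrite /constructible_from cols1; apply: good_reach; split=> //.
    exact: cols_nonneg.
  exact: cols_spanning.
by apply/minors3_tnn/(reach_tnn cM)/tnn_cols1.
Qed.
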